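(* Let $n\ge 4$, let $G=\operatorname{Alt}([n])$, and let $\mathcal{V}$ be a system of $n$ subsets $V_1,\ldots,V_n$ of $[n]$. Then $G$ satisfies the $(n-1)$-orbit condition subject to $\mathcal{V}$ if and only if $G$ has a $G$-marriage subject to $\mathcal{V}$.
   Context: $[n]=\{1,\ldots,n\}$, $\operatorname{Sym}([n])$ is the group of all permutations of $[n]$, and $\operatorname{Alt}([n])$ is the alternating group, i.e. the subgroup of even permutations. A system $\mathcal{V}$ of $n$ subsets of $[n]$ is an indexed family $V_1,\ldots,V_n$ with each $V_i\subseteq [n]$. A subgroup $G\le \operatorname{Sym}([n])$ has a $G$-marriage subject to $\mathcal{V}$ if there exists $g\in G$ with $g(i)\in V_i$ for every $i\in[n]$. For $k\in[n]$ and $\mathbf{y}=(y_1,\ldots,y_k)\in[n]^k$ write $V_{\mathbf{y}}=V_{y_1}\times\cdots\times V_{y_k}\subseteq [n]^k$. $G$ satisfies the $k$-orbit condition subject to $\mathcal{V}$ if for every non-empty $Y\subseteq[n]^k$ there is $g\in G$ such that $Y^g\subseteq\bigcup_{\mathbf{y}\in Y}V_{\mathbf{y}}$, where $Y^g=\{(g(y_1),\ldots,g(y_k)) : (y_1,\ldots,y_k)\in Y\}$. *)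

(* Defs.v *)
From mathcomp Require Import all_boot all_fingroup all_solvable.

Set Implicit Arguments.
Unset Strict Implicit.
Unset Printing Implicit Defensive.

(* The ground set [n] = {1, ..., n} is represented by 'I_n = {0, ..., n-1}. *)

Section OrbitCondition.

Variable n : nat.

Implicit Types (G : {group {perm 'I_n}}) (V : 'I_n -> {set 'I_n}).

Definition has_marriage G V : Prop :=
  exists2 g : {perm 'I_n}, g \in G & forall i : 'I_n, g i \in V i.

(* V_y = V_{y_1} x ... x V_{y_k} *)
Definition Vprod V (k : nat) (y : k.-tuple 'I_n) : {set k.-tuple 'I_n} :=
  [set z : k.-tuple 'I_n | [forall j : 'I_k, tnth z j \in V (tnth y j)]].

(* Y^g for the coordinatewise action of g *)
Definition perm_tuples (k : nat) (g : {perm 'I_n}) (Y : {set k.-tuple 'I_n}) :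
    {set k.-tuple 'I_n} :=
  [set map_tuple g y | y in Y].

Definition orbit_condition (k : nat) G V : Prop :=
  forall Y : {set k.-tuple 'I_n}, Y != set0 ->
    exists2 g : {perm 'I_n}, g \in G &
      perm_tuples g Y \subset \bigcup_(y in Y) Vprod V y.

End OrbitCondition.

(* Main.v *)
Require Import Defs.
From mathcomp Require Import all_boot all_fingroup all_solvable.
From mathcomp Require Import zify.

(** A marriage g sends each Y into the union of the V_y, so only the direct
implication has content.  Suppose that Alt has no marriage, and let K be an
abelian group of even permutations that is transitive on a set O with at least
four points and at most one point outside.  Such a K acts regularly on O.
Let the Y of the orbit condition consist of the K-images of an enumeration of
the complement of a point x of O.  The permutation g that it provides has this
property: for each value o in O there is an h in the coset K * g such that
h i is in V i for every i, except possibly for the row i with h i = g o.  Since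
h is even it is not a marriage, so it does fail in that row; hence different
values o give different h.  As K and O have the same cardinality, each member of
the coset fails in exactly one row, and each value in g(O) is missing from
exactly one V_i with i in O.  The sets V_i are thus nearly full, and one member
of the coset can be repaired into an even marriage (lemmas [near_marriage] and
[abelian_marriage]).

The repair composes h with a 3-cycle through the failing row i whenever V_i
contains a value of h on O.  Otherwise V_i contains only the value at the single
point c outside O, every other V_l with l in O contains all of h(O), and Hall's
condition for the rows i and c, which also follows from the orbit condition,
leaves room to move c: a 3-cycle or a double transposition repairs h.

It remains to find K.  For n odd, a cycle of length n generates it; for n even
and at least 6, a cycle of length n - 1; for n = 4, where a 3-cycle moves too
few points, K is the Klein four-group. *)

Set Implicit Arguments.
Unset Strict Implicit.
Unset Printing Implicit Defensive.

(** * Consequences of the orbit condition *)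

Section Consequences.

Local Open Scope group_scope.

Variables (n : nat) (G : {group {perm 'I_n}}) (V : 'I_n -> {set 'I_n}).

Lemma marriage_orbit_condition k : has_marriage G V -> orbit_condition k G V.
Proof.
case=> g gG gV Y _; exists g => //; apply/subsetP=> _ /imsetP[y yY ->].
apply/bigcupP; exists y => //; rewrite inE; apply/forallP=> j.
by rewrite tnth_map.
Qed.

Lemma has_marriageP :
  reflect (has_marriage G V) [exists (g | g \in G), [forall i, g i \in V i]].
Proof.
apply: (iffP exists_inP) => -[g gG].
  by move/forallP; exists g.
by move=> gV; exists g => //; apply/forallP.
Qed.

(** Constant tuples turn the orbit condition into a form of Hall's condition. *)
Lemma orbit_condition_set k (S : {set 'I_n}) : 0 < k -> orbit_condition k G V ->
  S != set0 ->
  exists2 g, g \in G & {in S, forall s, exists2 t, t \in S & g s \in V t}.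
Proof.
case: k => // k _ orbG /set0Pn[s0 s0S].
pose cst (s : 'I_n) := nseq_tuple k.+1 s.
case: (orbG [set cst s | s in S]).
  by apply/set0Pn; exists (cst s0); apply: imset_f.
move=> g gG /subsetP gY; exists g => // s sS.
have /bigcupP[_ /imsetP[t tS ->]] := gY _ (imset_f _ (imset_f cst sS)).
rewrite inE => /forallP/(_ ord0).
by rewrite tnth_map !tnth_nseq; exists t.
Qed.

(** A tuple that enumerates the points other than x determines a permutation
up to the value at x, and Y consists of the images of this tuple under K. *)
Lemma orbit_condition_perms (K : {set {perm 'I_n}}) x :
  orbit_condition (n - 1) G V -> K != set0 ->
  exists2 g, g \in G &
    {in K, forall k : {perm 'I_n}, exists2 k' : {perm 'I_n}, k' \in K &
      forall j, j != x -> g (k j) \in V (k' j)}.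
Proof.
move=> orbG /set0Pn[k0 k0K].
have sz : size (enum [set~ x]) == n - 1.
  by rewrite -cardE cardsC1 card_ord subn1.
pose y0 := Tuple sz.
case: (orbG [set map_tuple k y0 | k : {perm 'I_n} in K]).
  by apply/set0Pn; exists (map_tuple k0 y0); apply: imset_f.
move=> g gG /subsetP gY; exists g => // k kK.
have /bigcupP[_ /imsetP[k' k'K ->]] :=
  gY _ (imset_f _ (imset_f (fun k : {perm 'I_n} => map_tuple k y0) kK)).
rewrite inE => /forallP kk'; exists k' => // j jx.
have /tnthP[a ja] : j \in y0 by rewrite mem_enum !inE.
by have := kk' a; rewrite !tnth_map -ja.
Qed.

End Consequences.

(** * From a transitive abelian group of even permutations to a marriage *)

Section Core.

Local Open Scope group_scope.

Variable n : nat.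

(** If k fixes i it fixes the whole K-orbit O of i, because K is abelian; the
at most one remaining point is then fixed too. *)
Lemma abelian_transitive_free (K : {group {perm 'I_n}}) (O : {set 'I_n}) :
  abelian K -> [transitive K, on O | 'P] -> #|~: O| <= 1 ->
  {in K & O, forall (k : {perm 'I_n}) i, k i = i -> k = 1}.
Proof.
move=> abK trK O1 k i kK iO ki.
have fixO j : j \in O -> k j = j.
  move=> jO; have [k' k'K ->] := atransP2 trK iO jO.
  by rewrite /= apermE -permM -(centsP abK _ kK _ k'K) permM ki.
apply/permP=> j; rewrite perm1; have [jO|jO] := boolP (j \in O).
  exact: fixO.
apply: (card_le1_eqP O1); rewrite inE //.
apply: contra jO => kjO; rewrite -(perm_inj (fixO _ kjO)) //.
Qed.

(** The coset K * g, where g comes from the orbit condition for K, is sharply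
transitive from O to g(O).  Each value g o is attached to a member kap o * g of
the coset that can fail only in the row where it takes this value, and does fail
there; so kap is a bijection from O to K.  If g o is outside V a, then the
member of the coset that takes a to g o is the one attached to o; its failing
row is unique, whence the last clause: a column of h(O) has at most one missing
row in O. *)
Lemma near_marriage (V : 'I_n -> {set 'I_n}) (K : {group {perm 'I_n}})
    (O : {set 'I_n}) :
    K \subset 'Alt_('I_n) -> abelian K -> [transitive K, on O | 'P] ->
    #|~: O| <= 1 -> O != set0 ->
    orbit_condition (n - 1) 'Alt_('I_n)%G V ->
    ~ has_marriage 'Alt_('I_n)%G V ->
  exists2 h : {perm 'I_n}, h \in 'Alt_('I_n) & exists2 i, i \in O &
    [/\ h i \notin V i, forall j, j != i -> h j \in V j &
        {in O & &, forall a b l, h l \notin V a -> h l \notin V b -> a = b}].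
Proof.
move=> KA abK trK O1 /set0Pn[x xO] orb noM.
have freeK := abelian_transitive_free abK trK O1.
have KO k i : k \in K -> (k i \in O) = (i \in O).
  by move=> kK; have /actsP/(_ k kK i) := atrans_acts trK.
have Kn0 : (K : {set _}) != set0 by apply/set0Pn; exists 1; apply: group1.
have [g gA gK] := orbit_condition_perms x orb Kn0.
have hA k : k \in K -> k * g \in 'Alt_('I_n).
  by move=> kK; rewrite groupM // (subsetP KA).
have /fin_all_exists[kap kapP] : forall o, exists k : {perm 'I_n}, o \in O ->
    k \in K /\ forall i, k i != o -> g (k i) \in V i.
  move=> o; have [oO|_] := boolP (o \in O); last by exists 1.
  have [k kK ok] := atransP2 trK xO oO; have [k' k'K gkk'] := gK _ kK.
  (* The row in which k'^-1 * k * g may fail is k' x, where it takes the value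
     g (k x) = g o. *)
  exists (k'^-1 * k) => _; split; first by rewrite groupM ?groupV.
  move=> i; rewrite permM => io; rewrite -{2}(permKV k' i); apply: gkk'.
  by apply: contra io => /eqP ->; rewrite ok.
have kapK o : o \in O -> kap o \in K by case/kapP.
have kapV o i : o \in O -> kap o i != o -> g (kap o i) \in V i.
  by case/kapP=> _; apply.
have kap_inj : {in O &, injective kap}.
  (* A permutation attached to two values fails in no row. *)
  move=> o o' oO o'O kk; apply/eqP/negPn/negP => oo'; case: noM.
  exists (kap o * g); first exact/hA/kapK.
  move=> i; rewrite permM; have [ko|] := eqVneq (kap o i) o; last exact: kapV.
  by rewrite kk kapV // -kk ko.
have kapO : kap @: O = K.
  apply/eqP; rewrite eqEcard; apply/andP; split.
    by apply/subsetP=> _ /imsetP[o oO ->]; apply: kapK.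
  rewrite card_in_imset // -(card_in_imset (f := fun k : {perm 'I_n} => k x)).
    by apply/subset_leq_card/subsetP=> _ /imsetP[k kK ->]; rewrite KO.
  move=> k k' kK k'K kk'; apply/eqP; rewrite eq_mulgV1; apply/eqP.
  apply: (freeK _ x) => //; first by rewrite groupM ?groupV.
  by rewrite permM kk' permK.
have bad_uniq :
    {in O & &, forall a b o, g o \notin V a -> g o \notin V b -> a = b}.
  have bad_kap a o : a \in O -> o \in O -> g o \notin V a -> kap o a = o.
    move=> aO oO ga; have [k kK ak] := atransP2 trK aO oO.
    move: kK ak; rewrite -kapO => /imsetP[o' o'O ->] /esym oE.
    have [oo'|oo'] := eqVneq o o'; first by rewrite [in LHS]oo'.
    by case/negP: ga; rewrite -oE; apply: kapV => //; rewrite [X in X != _]oE.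
  move=> a b o aO bO oO ga gb; apply: (@perm_inj _ (kap o)).
  by rewrite !bad_kap.
have kxK := kapK _ xO; set i := (kap x)^-1 x.
have kix : kap x i = x by rewrite permKV.
have good j : j != i -> g (kap x j) \in V j.
  by move=> ji; apply: kapV => //; rewrite -[X in _ != X]kix (inj_eq perm_inj).
exists (kap x * g); first exact: hA.
exists i; first by rewrite -(KO (kap x)) ?kix.
split.
- apply/negP=> gi; case: noM; exists (kap x * g); first exact: hA.
  move=> j; have [-> //|ji] := eqVneq j i.
  by rewrite permM good.
- by move=> j ji; rewrite permM good.
move=> a b l aO bO lO; rewrite !permM; apply: bad_uniq => //.
by rewrite KO.
Qed.

(** Preceding h by the 3-cycle i -> j -> l -> i, which is even, changes only the
values in these rows. *)
Lemma rotate_marriage (V : 'I_n -> {set 'I_n}) (h : {perm 'I_n}) i j l :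
    h \in 'Alt_('I_n) -> i != j -> j != l -> l != i ->
    h j \in V i -> h l \in V j -> h i \in V l ->
    (forall a, a != i -> a != j -> a != l -> h a \in V a) ->
  has_marriage 'Alt_('I_n)%G V.
Proof.
move=> hA ij jl li hj hl hi hV; exists (tperm i l * tperm l j * h).
  by rewrite groupM // Alt_even odd_permM !odd_tperm eq_sym li eq_sym jl.
move=> a; rewrite !permM; have [->|ai] := eqVneq a i; first by rewrite !tpermL.
have [->|al] := eqVneq a l.
  by rewrite tpermR tpermD // 1?eq_sym.
rewrite (tpermD (z := a)) 1?eq_sym //.
have [->|aj] := eqVneq a j; first by rewrite tpermR.
by rewrite tpermD 1?eq_sym //; apply: hV.
Qed.

(** The single failing row i of the even permutation h from [near_marriage] is
repaired by a 3-cycle inside O when V i meets h(O), and otherwise by exchanging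
values with the point c outside O. *)
Lemma abelian_marriage (V : 'I_n -> {set 'I_n}) (K : {group {perm 'I_n}})
    (O : {set 'I_n}) :
    K \subset 'Alt_('I_n) -> abelian K -> [transitive K, on O | 'P] ->
    #|~: O| <= 1 -> 3 < #|O| ->
    orbit_condition (n - 1) 'Alt_('I_n)%G V ->
  has_marriage 'Alt_('I_n)%G V.
Proof.
move=> KA abK trK O1 O4 orb; have [//|noM] := has_marriageP 'Alt_('I_n)%G V.
have On0 : O != set0 by rewrite -card_gt0; lia.
have [h hA [i iO [hi hV colV]]] := near_marriage KA abK trK O1 On0 orb noM.
have n1 : 0 < n - 1 by have := max_card O; rewrite card_ord; lia.
have two_more a : a \in O ->
    exists b, exists c, [/\ b \in O, c \in O, b != c &
                         [/\ b != i, b != a, c != i & c != a]].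
  move=> aO; have : 1 < #|O :\ i :\ a|.
    have := cardsD1 i O; have := cardsD1 a (O :\ i).
    by move: (i \in O) (a \in O :\ i) => [] []; lia.
  case/card_gt1P=> b [c] [].
  rewrite !in_setD1 => /and3P[ba bi bO] /and3P[ca ci cO] bc.
  by exists b, c.
have [/exists_inP[j jO hj]|noj] := boolP [exists (j | j \in O), h j \in V i].
  have ji : j != i by apply: contraNneq hi => ji; rewrite -{1}ji.
  have hl l : l \in O -> l != i -> h i \in V l.
    move=> lO li; apply/negPn/negP=> hl.
    by case/eqP: li; apply: (colV l i i).
  have [/exists_inP[l lO /and3P[li lj hlj]]|nol] :=
    boolP [exists (l | l \in O), [&& l != i, l != j & h l \in V j]].
    apply: (rotate_marriage (i := i) (j := j) (l := l) hA) => //.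
    - by rewrite eq_sym.
    - by rewrite eq_sym.
    - exact: hl.
    by move=> a ai _ _; apply: hV.
  (* Now V j misses h l for all l in O other than i and j, so no other row of O
     misses these values, and i can rotate with two of these l instead. *)
  have {nol} nol l : l \in O -> l != i -> l != j -> h l \notin V j.
    move=> lO li lj; apply: contra nol => hlj.
    by apply/exists_inP; exists l; rewrite ?li ?lj.
  have good l a : l \in O -> l != i -> l != j -> a \in O -> a != j ->
      h l \in V a.
    move=> lO li lj aO aj; apply/negPn/negP=> hla.
    by case/eqP: aj; apply: (colV a j l) => //; apply: nol.
  have [b [c [bO cO bc [bi bj ci cj]]]] := two_more j jO.
  apply: (rotate_marriage (i := i) (j := b) (l := c) hA) => //.
  - by rewrite eq_sym.
  - by apply: good; rewrite // eq_sym.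
  - exact: good.
  - exact: hl.
  by move=> a ai _ _; apply: hV.
(* Now V i is disjoint from h(O), so every other row of O contains h(O). *)
have {noj} noj j : j \in O -> h j \notin V i.
  by move=> jO; apply: contra noj => hj; apply/exists_inP; exists j.
have good j l : j \in O -> l \in O -> l != i -> h j \in V l.
  move=> jO lO li; apply/negPn/negP=> hjl.
  by case/eqP: li; apply: (colV l i j) => //; apply: noj.
have [g1 _ /(_ i (set11 i))[_ /set1P-> g1i]] :
  exists2 g, g \in 'Alt_('I_n) &
    {in [set i], forall s, exists2 t, t \in [set i] & g s \in V t}.
  apply: (orbit_condition_set n1 orb).
  by apply/set0Pn; exists i; rewrite set11.
set c := h^-1 (g1 i).
have hc : h c \in V i by rewrite permKV.
have cO : c \notin O by apply: contraL hc; apply: noj.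
have outO d : d \notin O -> d = c.
  by move=> dO; apply: (card_le1_eqP O1); rewrite inE.
have ci : c != i by apply: contraNneq cO => ->.
have [g2 _ g2P] : exists2 g, g \in 'Alt_('I_n) &
    {in [set i; c], forall s, exists2 t, t \in [set i; c] & g s \in V t}.
  apply: (orbit_condition_set n1 orb).
  by apply/set0Pn; exists i; rewrite set21.
have [/exists_inP[o oO hoc]|noo] :=
  boolP [exists (o | o \in O), h o \in V c]; last first.
  (* Otherwise h c would be the only value available to the rows i and c. *)
  have only_c s : s \in [set i; c] -> g2 s = h c.
    move=> /g2P[t tic gst]; rewrite -[g2 s](permKV h); congr (h _); apply: outO.
    apply/negP=> oO; case/set2P: tic gst => ->; rewrite -[g2 s](permKV h).
      by apply/negP; apply: noj.
    by move=> gsc; case/exists_inP: noo; exists (h^-1 (g2 s)).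
  case/eqP: ci; apply: (@perm_inj _ g2).
  by rewrite !only_c ?set21 ?set22.
have [oi|oi] := eqVneq o i; last first.
  apply: (rotate_marriage (i := i) (j := c) (l := o) hA) => //.
  - by rewrite eq_sym.
  - by apply: contraNneq cO => ->.
  - exact: good.
  by move=> a ai _ _; apply: hV.
(* The value of h(O) found for the row c is h i, so the rows i and c exchange
   their values; exchanging those of two further rows of O keeps the
   permutation even. *)
have [a [b [aO bO ab [ai _ bi _]]]] := two_more i iO.
have ac : a != c by apply: contraNneq cO => <-.
have bc : b != c by apply: contraNneq cO => <-.
exists (tperm i c * tperm a b * h).
  by rewrite groupM // Alt_even odd_permM !odd_tperm ab eq_sym ci.
move=> d; rewrite !permM; have [->|di] := eqVneq d i.
  by rewrite tpermL tpermD.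
have [->|dc] := eqVneq d c.
  by rewrite tpermR tpermD // -oi.
rewrite (tpermD (z := d)) 1?eq_sym //.
have [->|da] := eqVneq d a; first by rewrite tpermL; apply: good.
have [->|db] := eqVneq d b; first by rewrite tpermR; apply: good.
by rewrite tpermD 1?eq_sym //; apply: hV.
Qed.

End Core.

(** * Existence of the transitive abelian group *)

Section AbelianTransitive.

Local Open Scope group_scope.

(** The cyclic group generated by (0 1 ... m-1); the generator is even because
its odd power m is the identity. *)
Lemma cyclic_odd (n m : nat) : odd m -> 3 < m -> m <= n <= m.+1 ->
  exists (K : {group {perm 'I_n}}) (O : {set 'I_n}),
    [/\ K \subset 'Alt_('I_n), abelian K, [transitive K, on O | 'P],
        #|~: O| <= 1 & 3 < #|O|].
Proof.
move=> oddm m3 /andP[mn nm].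
have m0 : 0 < m by lia.
pose next (i : 'I_n) : nat := if i < m then i.+1 %% m else i.
have next_lt i : next i < n.
  rewrite /next; case: ifP => // _; apply: leq_trans mn; exact: ltn_pmod.
pose f (i : 'I_n) := Ordinal (next_lt i).
have f_inj : injective f.
  move=> i j /(congr1 val) /=; rewrite /next => fij; apply: val_inj => /=.
  move: fij; case: ifP => im; case: ifP => jm => fij.
  - move/eqP: fij; rewrite -[i.+1]addn1 -[j.+1]addn1 eqn_modDr !modn_small //.
    by move/eqP.
  - by have := ltn_pmod i.+1 m0; rewrite fij jm.
  - by have := ltn_pmod j.+1 m0; rewrite -fij im.
  by [].
pose c := perm f_inj.
have cX_in k (i : 'I_n) : i < m -> (c ^+ k) i = (i + k) %% m :> nat.
  move=> im; elim: k => [|k IHk]; first by rewrite perm1 addn0 modn_small.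
  rewrite expgSr permM permE /= /next IHk ltn_pmod //.
  by rewrite -[((i + k) %% m).+1]addn1 modnDml addn1 addnS.
have cX_out k (i : 'I_n) : m <= i -> (c ^+ k) i = i.
  move=> im; elim: k => [|k IHk]; first by rewrite perm1.
  rewrite expgSr permM IHk permE; apply: val_inj => /=.
  by rewrite /next ltnNge im.
have cm : c ^+ m = 1.
  apply/permP=> i; rewrite perm1; have [im|im] := ltnP i m; last exact: cX_out.
  by apply: val_inj; rewrite /= cX_in // modnDr modn_small.
have even_c : ~~ odd_perm c.
  have parX k : odd_perm (c ^+ k) = odd k && odd_perm c.
    elim: k => [|k IHk]; first by rewrite odd_perm1.
    by rewrite expgS odd_permM IHk /=; case: (odd k); case: (odd_perm c).
  by rewrite -[odd_perm c]andTb -oddm -parX cm odd_perm1.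
pose O := [set i : 'I_n | i < m].
have cardO : #|O| = m.
  have <- : #|[set widen_ord mn i | i : 'I_m]| = m.
    by rewrite card_imset ?card_ord // => i j /(congr1 val) /= /val_inj.
  congr #|pred_of_set _|; apply/setP=> i; rewrite inE; apply/idP/imsetP.
    by move=> im; exists (Ordinal im) => //; apply: val_inj.
  by case=> j _ ->; apply: (ltn_ord j).
exists <[c]>, O; split.
- by rewrite cycle_subG Alt_even.
- exact: cycle_abelian.
- have n0 : 0 < n by lia.
  apply/imsetP; exists (Ordinal n0); first by rewrite inE.
  apply/setP=> i; rewrite inE; apply/idP/orbitP.
    move=> im; exists (c ^+ i); first exact: mem_cycle.
    by apply: val_inj; rewrite /= apermE cX_in //= add0n modn_small.
  case=> _ /cycleP[k ->] <-; rewrite /= apermE cX_in //.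
  exact: ltn_pmod.
- by rewrite -(leq_add2l m) -[X in X + #|_|]cardO cardsC card_ord addn1.
by rewrite cardO.
Qed.

Lemma klein_four : exists (K : {group {perm 'I_4}}) (O : {set 'I_4}),
    [/\ K \subset 'Alt_('I_4), abelian K, [transitive K, on O | 'P],
        #|~: O| <= 1 & 3 < #|O|].
Proof.
pose o0 := @Ordinal 4 0 isT; pose o1 := @Ordinal 4 1 isT.
pose o2 := @Ordinal 4 2 isT; pose o3 := @Ordinal 4 3 isT.
pose s := tperm o0 o1 * tperm o2 o3.
pose t := tperm o0 o2 * tperm o1 o3.
have all4 (P : 'I_4 -> Prop) : P o0 -> P o1 -> P o2 -> P o3 -> forall i, P i.
  move=> P0 P1 P2 P3 [i ltin]; move: i ltin.
  by do 4?[case=> [ltin|]; first by rewrite (bool_irrelevance ltin isT)].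
have sE : [/\ s o0 = o1, s o1 = o0, s o2 = o3 & s o3 = o2].
  by split; do !rewrite !permE /=.
have tE : [/\ t o0 = o2, t o1 = o3, t o2 = o0 & t o3 = o1].
  by split; do !rewrite !permE /=.
case: sE => s0 s1 s2 s3; case: tE => t0 t1 t2 t3.
have st : commute s t.
  clearbody s t; apply/permP; apply: all4;
  by rewrite !permM !(s0, s1, s2, s3, t0, t1, t2, t3).
exists <<[set s; t]>>%G, setT; split.
- rewrite gen_subG; apply/subsetP=> k /set2P[] ->;
  by rewrite Alt_even odd_permM !odd_tperm.
- rewrite abelian_gen; apply/centsP.
  move=> a /set2P[] -> b /set2P[] ->; rewrite /commute //.
- apply/imsetP; exists o0 => //; apply/setP=> i; rewrite inE; apply/esym.
  have sK : s \in <<[set s; t]>> by rewrite mem_gen // set21.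
  have tK : t \in <<[set s; t]>> by rewrite mem_gen // set22.
  apply/orbitP; move: i; apply: all4.
  + by exists 1; rewrite ?group1 //= ?apermE perm1.
  + by exists s.
  + by exists t.
  by exists (s * t); [rewrite groupM | rewrite -[LHS]/((s * t) o0) permM s0 t1].
- by rewrite setCT cards0.
by rewrite cardsT card_ord.
Qed.

Lemma even_abelian_transitive n : 3 < n ->
  exists (K : {group {perm 'I_n}}) (O : {set 'I_n}),
    [/\ K \subset 'Alt_('I_n), abelian K, [transitive K, on O | 'P],
        #|~: O| <= 1 & 3 < #|O|].
Proof.
move=> n4; have [oddn|evenn] := boolP (odd n).
  by apply: (@cyclic_odd n n); lia.
have [n_eq4|n_neq4] := eqVneq n 4; first by rewrite n_eq4; apply: klein_four.
by apply: (@cyclic_odd n n.-1); lia.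
Qed.

End AbelianTransitive.

Theorem theorem1p7 (n : nat) (hn : 4 <= n) (V : 'I_n -> {set 'I_n}) :
  orbit_condition (n - 1) 'Alt_('I_n)%G V <-> has_marriage 'Alt_('I_n)%G V.
Proof.
split; last exact: marriage_orbit_condition.
have [K [O [KA abK trK O1 O4]]] := even_abelian_transitive hn.
exact: abelian_marriage KA abK trK O1 O4.
Qed.
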